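(* Let $Z, U \subseteq \mathbb{C}^n$ be two compact origin-centered Reinhardt domains. Then for every integer $t \ge n$, $$\mathsf{M}_t(Z|U) = \mathsf{M}_t(Z_+|U_\pm) = \sup_{(r_1,\dots,r_n) \in Z_+,\ (w_1,\dots,w_n) \in U_+}\ \sum_{k=1}^n w_k\, s_{(t-n|n-k)}(r_1,\dots,r_n).$$
   Context: Let $n \ge 1$. A set $D \subseteq \mathbb{C}^n$ is called an origin-centered Reinhardt domain if together with any $(z_1,\dots,z_n) \in D$ it contains every $(\tilde z_1,\dots,\tilde z_n) \in \mathbb{C}^n$ with $|\tilde z_k| = |z_k|$ for all $k$ (no openness or connectedness is required). For such $D$, $$D_+ := \{(|z_1|,\dots,|z_n|) : (z_1,\dots,z_n) \in D\}, \qquad D_\pm := \{(\pm|z_1|,\dots,\pm|z_n|) : (z_1,\dots,z_n) \in D\},$$ where in $D_\pm$ all independent choices of signs are allowed. For a monic polynomial $f(z) = \sum_{k=0}^n f_k z^k$ ($f_n = 1$) of degree $n$, let $X(f)$ be the set of complex sequences $x = (x_0,x_1,\dots)$ with $\sum_{k=0}^n f_k x_{s+k} = 0$ for all integers $s \ge 0$. For $U \subseteq \mathbb{C}^n$, define $M_t(f|U) := \sup\{|x_t| : x \in X(f),\ (x_0,\dots,x_{n-1}) \in U\}$. For $Z \subseteq \mathbb{C}^n$, define $\mathsf{M}_t(Z|U) := \sup M_t(f|U)$, the supremum being over all $f(z) = \prod_{j=1}^n (z - z_j)$ with $(z_1,\dots,z_n) \in Z$. For integers $a,b \ge 0$, $(a|b)$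 denotes the hook partition $(a+1,1,\dots,1)$ with $b$ trailing ones, and $s_{(a|b)}(x_1,\dots,x_n)$ is the corresponding Schur polynomial: the sum, over all semistandard Young tableaux of shape $(a|b)$ (rows weakly increasing, columns strictly increasing) with entries in $\{1,\dots,n\}$, of the product of $x_i$ over the entries $i$ of the tableau. *)

(* Defs.v *)
From HB Require Import structures.
From mathcomp Require Import all_boot all_order all_algebra.
From mathcomp Require Import complex.
From mathcomp Require Import all_classical all_reals all_analysis.

Set Implicit Arguments.
Unset Strict Implicit.
Unset Printing Implicit Defensive.

Import Order.TTheory GRing.Theory Num.Theory.
Import numFieldNormedType.Exports.

Local Open Scope classical_set_scope.
Local Open Scope ring_scope.

(* MathComp-Analysis puts the norm topology on the alias [R[i]^o], not on
   [R[i]] itself; the matrix type over it carries the product topology. *)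
Definition compactC (R : realType) (n : nat) (D : set 'rV[R[i]]_n) : Prop :=
  compact (D : set 'rV[R[i]^o]_n).

Definition Reinhardt (R : realType) (n : nat) (D : set 'rV[R[i]]_n) : Prop :=
  forall z w : 'rV[R[i]]_n,
    D z -> (forall k, `|w 0 k| = `|z 0 k|) -> D w.

(* [D_+] and [D_±] as sets of real vectors; [inC] is the inclusion of
   the real n-space into the complex one. [normc z] is the modulus of [z] as an
   element of [R], whereas [`|z|] has type [R[i]]. *)
Definition absset (R : realType) (n : nat) (D : set 'rV[R[i]]_n) :
    set 'rV[R]_n :=
  [set \row_k Normc.normc (z 0 k) | z in D].

Definition signedset (R : realType) (n : nat) (D : set 'rV[R[i]]_n) :
    set 'rV[R]_n :=
  [set \row_k ((-1) ^+ e k * Normc.normc (z 0 k))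
     | z in D & e in [set: 'I_n -> bool]].

Definition inC (R : realType) (n : nat) (A : set 'rV[R]_n) :
    set 'rV[R[i]]_n :=
  [set map_mx (real_complex R) x | x in A].

Definition recseq (R : realType) (f : {poly R[i]}) : set (nat -> R[i]) :=
  [set x | forall s : nat, \sum_(k < size f) f`_k * x (s + k)%N = 0].

(* Suprema are taken in the extended reals, with [-oo] for the empty set. *)
Definition Msup (R : realType) (n t : nat) (f : {poly R[i]})
    (U : set 'rV[R[i]]_n) : \bar R :=
  ereal_sup [set (Normc.normc (x t))%:E
    | x in [set x | recseq f x /\ U (\row_(k < n) x k)]].

Definition MMsup (R : realType) (n t : nat) (Z U : set 'rV[R[i]]_n) : \bar R :=
  ereal_sup [set Msup t (\prod_(j < n) ('X - (z 0 j)%:P)) U | z in Z].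

(* The boxes of the Young diagram of [sh] are the pairs of a row [i] and
   a column [j < sh_i], encoded as a dependent sum. *)
Definition box (sh : seq nat) : finType :=
  {i : 'I_(size sh) & 'I_(nth 0%N sh i)}.

Definition semistandard (sh : seq nat) (n : nat)
    (T : {ffun box sh -> 'I_n}) : bool :=
  [forall c : box sh, forall d : box sh,
     ((tag c == tag d) && (tagged c <= tagged d)%N ==> (T c <= T d)%N)
     && ((tag c < tag d)%N && (tagged c == tagged d :> nat)
         ==> (T c < T d)%N)].

Definition schur (R : realType) (sh : seq nat) (n : nat) (x : 'rV[R]_n) : R :=
  \sum_(T : {ffun box sh -> 'I_n} | semistandard T) \prod_(c : box sh) x 0 (T c).

Definition hook (a b : nat) : seq nat := a.+1 :: nseq b 1%N.

(* Main.v *)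
Require Import Defs.
From HB Require Import structures.
From mathcomp Require Import all_boot all_order all_algebra.
From mathcomp Require Import complex.
From mathcomp Require Import all_classical all_reals all_analysis.
From mathcomp Require Import -(notations) mpoly.
From mathcomp Require Import zify ring.

(** A sequence [x] satisfying the recurrence with characteristic roots
[z_1, ..., z_n] is determined by its first [n] terms, and for [n <= t]
<<
    x_t = \sum_(k < n) (-1)^(n-k-1) s_(t-n | n-k-1)(z) x_k
>>
where [s_(a|b)] is the Schur polynomial of a hook
([recurrence_closed_form] and [schur_hook]). Schur polynomials have
nonnegative coefficients, so the triangle inequality bounds [|x_t|] by
[\sum_k |x_k| s_(t-n | n-k-1)(|z|)] ([normc_term_le]). When the roots are
nonnegative reals and [x_k = (-1)^(n-k-1) w_k] with [w_k >= 0], all the terms of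
the closed form are nonnegative and the bound is attained
([real_extremal_sequence]).
For Reinhardt domains, [Z_+] and [U_±] are contained in [Z] and [U], hence
<<
    sup of the sums <= M_t(Z_+ | U_±) <= M_t(Z | U) <= sup of the sums.
>>

The closed form comes from an induction on [t - n]. At [t = n] it is Vieta's
formula, as [s_(0|b)] is the elementary symmetric polynomial of degree [b + 1].
The step applies the induction hypothesis to the shifted sequence and eliminates
[x_n]; the coefficients agree by Pieri's rule
[s_(a|0) s_(0|b) = s_(a+1|b) + s_(a|b+1)] ([hook_sum_pieri]).
To make this rule easy, a hook tableau is cut into its corner entry [m], a
weakly increasing arm starting from [m] and a strictly increasing leg starting
from [m]; this writes [s_(a|b)] as [hook_sum a b], over any commutative ring. *)

Set Implicit Arguments.
Unset Strict Implicit.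
Unset Printing Implicit Defensive.

Import Order.TTheory GRing.Theory Num.Theory.

Local Open Scope classical_set_scope.
Local Open Scope ring_scope.

(** * Hook sums and Pieri's rule *)

Definition weak n : rel 'I_n := fun i j => (i <= j)%N.
Definition strict n : rel 'I_n := fun i j => (i < j)%N.

Arguments weak {n}.
Arguments strict {n}.

(** The complete homogeneous (for [weak]) or elementary (for [strict]) symmetric
polynomial of degree [a] in the variables whose index is [e]-above [m]. *)
Definition chain_sum (R : comNzRingType) n (e : rel 'I_n) (x : 'rV[R]_n)
    (a : nat) (m : 'I_n) : R :=
  \sum_(s : a.-tuple 'I_n | path e m s) \prod_(i <- s) x 0 i.

Definition hook_sum (R : comNzRingType) n (a b : nat) (x : 'rV[R]_n) : R :=
  \sum_(m < n) x 0 m * chain_sum weak x a m * chain_sum strict x b m.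

Lemma sum_tupleS (R : nmodType) (T : finType) a (P : pred (seq T))
    (F : seq T -> R) :
  \sum_(s : a.+1.-tuple T | P s) F s =
  \sum_(c : T) \sum_(s : a.-tuple T | P (c :: s)) F (c :: s).
Proof.
rewrite pair_big_dep /=.
rewrite (reindex (fun p : T * a.-tuple T => [tuple of p.1 :: p.2])) //=.
exists (fun s : a.+1.-tuple T => (thead s, [tuple of behead s])).
  move=> [c s] _.
  by congr pair; apply: val_inj.
by move=> s _; rewrite -tuple_eta.
Qed.

Section ChainSums.
Variables (R : comNzRingType) (n : nat) (x : 'rV[R]_n).

Lemma chain_sum0 (e : rel 'I_n) m : chain_sum e x 0 m = 1.
Proof.
rewrite /chain_sum (big_pred1 [tuple]) ?big_nil // => s.
by rewrite tuple0 /= eqxx.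
Qed.

Lemma chain_sumS (e : rel 'I_n) a m :
  chain_sum e x a.+1 m = \sum_(c | e m c) x 0 c * chain_sum e x a c.
Proof.
rewrite /chain_sum (sum_tupleS _ (path e m) (fun s => \prod_(i <- s) x 0 i)).
rewrite [RHS]big_mkcond; apply: eq_bigr => c _ /=.
case: (e m c) => /=; last by rewrite big_pred0.
by rewrite mulr_sumr; apply: eq_bigr => s _; rewrite big_cons.
Qed.

Lemma hook_sum_row a :
  hook_sum a 0 x = \sum_m x 0 m * chain_sum weak x a m.
Proof. by apply: eq_bigr => m _; rewrite chain_sum0 mulr1. Qed.

Lemma hook_sum_col b :
  hook_sum 0 b x = \sum_m x 0 m * chain_sum strict x b m.
Proof. by apply: eq_bigr => m _; rewrite chain_sum0 mulr1. Qed.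

(** A row with first entry [r] and a column with first entry [c] make up one
hook tableau: if [c <= r] the row is attached to [c] as its arm, and if [r < c]
the column is attached to [r] as its leg. *)
Lemma hook_sum_pieri a b :
  hook_sum a 0 x * hook_sum 0 b x = hook_sum a.+1 b x + hook_sum a b.+1 x.
Proof.
set A := fun m => x 0 m * chain_sum weak x a m.
set E := fun m => x 0 m * chain_sum strict x b m.
have -> : hook_sum a.+1 b x = \sum_c \sum_(r | weak c r) A r * E c.
  apply: eq_bigr => c _; rewrite chain_sumS mulrAC mulrC mulr_suml.
  by apply: eq_bigr.
have -> : hook_sum a b.+1 x = \sum_r \sum_(c | strict r c) A r * E c.
  by apply: eq_bigr => r _; rewrite chain_sumS mulr_sumr.
rewrite hook_sum_row hook_sum_col mulr_suml.
rewrite (exchange_big_dep xpredT) //= -big_split; apply: eq_bigr => r _ /=.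
rewrite mulr_sumr (bigID (weak^~ r)) /=; congr (_ + _).
by apply: eq_bigl => c; rewrite /weak /strict -ltnNge.
Qed.

Lemma path_strict_bound m s : path (@strict n) m s -> (m + size s < n)%N.
Proof.
elim: s m => [|c s IHs] m /=; first by rewrite addn0.
case/andP=> lt_mc /IHs; rewrite /strict in lt_mc; lia.
Qed.

(** A strictly increasing column has at most [n] entries in ['I_n]. *)
Lemma hook_sum_overflow a b : (n <= b)%N -> hook_sum a b x = 0.
Proof.
move=> le_nb; apply: big1 => m _.
rewrite [chain_sum strict _ _ _]big_pred0 ?mulr0 //.
move=> s; apply/negP => /path_strict_bound; rewrite size_tuple; lia.
Qed.

End ChainSums.

(** * Closed form of linear recurrent sequences *)

Lemma size_prod_XsubC_ord (R : nzRingType) n (z : 'I_n -> R) :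
  size (\prod_(j < n) ('X - (z j)%:P)) = n.+1.
Proof. by rewrite size_prod_XsubC /index_enum -enumT size_enum_ord. Qed.

Lemma coef_prod_XsubC_lead (R : idomainType) n (z : 'I_n -> R) :
  (\prod_(j < n) ('X - (z j)%:P))`_n = 1.
Proof.
have := monic_prod_XsubC (index_enum 'I_n) xpredT z.
by rewrite monicE lead_coefE size_prod_XsubC_ord => /eqP.
Qed.

(** Vieta's formula: the strictly increasing sequences [m :: s] of length
[n - k] index the monomials of the elementary symmetric polynomial. *)
Lemma coef_prod_XsubC_hook (R : idomainType) n (x : 'rV[R]_n) k : (k < n)%N ->
  (\prod_(j < n) ('X - (x 0 j)%:P))`_k =
  (-1) ^+ (n - k) * hook_sum 0 (n - k.+1) x.
Proof.
move=> lt_kn.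
have lt_nk : (n - k < n.+1)%N by lia.
have := mroots_coeff [tuple x 0 j | j < n] (Ordinal lt_nk).
rewrite /= subKn 1?ltnW // big_map big_enum /= => ->; congr (_ * _).
rewrite mesym_tupleE -[(n - k)%N]prednK ?subn_gt0 // subnS.
rewrite (sum_tupleS _ (@tmono n)
  (fun s => \prod_(i <- s) mpolyX R (mnm1 i))).
rewrite hook_sum_col (big_morph _ (mevalD _) (meval0 _)); apply: eq_bigr => m _.
rewrite (big_morph _ (mevalD _) (meval0 _)) mulr_sumr; apply: eq_big => s.
  by rewrite /tmono /= path_map.
move=> _; rewrite (big_morph _ (mevalM _) (meval1 _)) big_cons.
rewrite mevalXU tnth_mktuple.
by congr (_ * _); last apply: eq_bigr => i _; rewrite mevalXU tnth_mktuple.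
Qed.

(** Increasing [a] by one shifts the sequence: the coefficient of [x k] becomes
that of [x k.-1], plus a contribution of [x n] rewritten in terms of the initial
values. By [hook_sum_pieri] the latter splits into the expected coefficient and
a term cancelling the former. *)
Lemma recurrence_closed_form (R : idomainType) n (z : 'rV[R]_n)
    (f := \prod_(j < n) ('X - (z 0 j)%:P)) (x : nat -> R) :
  (forall s, \sum_(k < size f) f`_k * x (s + k)%N = 0) ->
  forall a, x (n + a)%N =
    \sum_(k < n) (-1) ^+ (n - k.+1) * hook_sum a (n - k.+1) z * x k.
Proof.
move=> xf a.
have step y : (forall s, \sum_(k < size f) f`_k * y (s + k)%N = 0) ->
    y n = \sum_(k < n) (-1) ^+ (n - k.+1) * hook_sum 0 (n - k.+1) z * y k.
  move=> /(_ 0%N).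
  rewrite /f size_prod_XsubC_ord big_ord_recr /= coef_prod_XsubC_lead mul1r.
  move=> /eqP; rewrite addrC addr_eq0 => /eqP ->.
  rewrite -sumrN; apply: eq_bigr => k _.
  by rewrite coef_prod_XsubC_hook // -(subnSK (ltn_ord k)) exprS; ring.
elim: a x xf => [|a IHa] x xf; first by rewrite addn0; exact: step.
have xfS s : \sum_(k < size f) f`_k * x (s + k).+1 = 0.
  by rewrite -[RHS](xf s.+1); apply: eq_bigr => k _; rewrite addSn.
rewrite addnS (IHa (fun s => x s.+1) xfS).
move: (step x xf) => {IHa xf xfS step f}.
case: n z => [|n] z xn; first by rewrite !big_ord0.
rewrite big_ord_recr /= subnn expr0 mul1r xn mulr_sumr.
have pieri (k : 'I_n.+1) : hook_sum a 0 z *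
    ((-1) ^+ (n.+1 - k.+1) * hook_sum 0 (n.+1 - k.+1) z * x k) =
    (-1) ^+ (n.+1 - k.+1) * hook_sum a.+1 (n.+1 - k.+1) z * x k +
    (-1) ^+ (n.+1 - k.+1) * hook_sum a (n.+1 - k.+1).+1 z * x k.
  by rewrite -mulrDl -mulrDr -hook_sum_pieri; ring.
rewrite (eq_bigr _ (fun k _ => pieri k)) big_split /= addrCA.
rewrite [X in _ + (_ + X)]big_ord_recl subn1 /= hook_sum_overflow //.
(* The shifted coefficients cancel the second half of Pieri's rule, the column
   of height [n.+2] at [k = 0] contributing nothing. *)
rewrite mulr0 mul0r add0r -[RHS]addr0; congr (_ + _).
rewrite -big_split /= big1 // => i _.
by rewrite !subSS /bump add1n -(subnSK (ltn_ord i)) exprS; ring.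
Qed.

(** * Schur polynomials of hooks *)

Lemma weak_refl n : reflexive (@weak n).
Proof. by move=> i; exact: leqnn. Qed.

Lemma weak_trans n : transitive (@weak n).
Proof. by move=> j i k; exact: leq_trans. Qed.

Lemma strict_trans n : transitive (@strict n).
Proof. by move=> j i k; exact: ltn_trans. Qed.

Lemma box_eq sh (c d : box sh) :
  tag c = tag d :> nat -> tagged c = tagged d :> nat -> c = d.
Proof.
case: c => [[i lt_i] [j lt_j]]; case: d => [[i' lt_i'] [j' lt_j']] /= eq_i.
case: i' / eq_i lt_i' lt_j' => lt_i'.
rewrite (bool_irrelevance lt_i' lt_i) => lt_j' /= eq_j.
by case: j' / eq_j lt_j' => lt_j'; rewrite (bool_irrelevance lt_j' lt_j).
Qed.

Lemma big_box (R : comNzRingType) sh (F : nat -> nat -> R) :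
  \prod_(c : box sh) F (tag c) (tagged c) =
  \prod_(0 <= i < size sh) \prod_(0 <= j < nth 0%N sh i) F i j.
Proof.
rewrite big_mkord.
under [RHS]eq_bigr => i _ do rewrite big_mkord.
by rewrite sig_big_dep.
Qed.

Section HookTableaux.
Variables (a b : nat).

Lemma arm_box_subproof (j : 'I_a.+1) : (j < nth 0%N (hook a b) 0)%N.
Proof. exact: ltn_ord. Qed.

Definition arm_box (j : 'I_a.+1) : box (hook a b) :=
  Tagged (fun i : 'I_(size (hook a b)) => 'I_(nth 0%N (hook a b) i))
    (i := ord0) (Ordinal (arm_box_subproof j)).

Lemma leg_row_subproof (i : 'I_b) : (i.+1 < size (hook a b))%N.
Proof. by rewrite /= size_nseq ltnS. Qed.

Lemma leg_col_subproof (i : 'I_b) : (0 < nth 0%N (hook a b) i.+1)%N.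
Proof. by rewrite /= nth_nseq ltn_ord. Qed.

Definition leg_box (i : 'I_b) : box (hook a b) :=
  Tagged (fun i : 'I_(size (hook a b)) => 'I_(nth 0%N (hook a b) i))
    (i := Ordinal (leg_row_subproof i)) (Ordinal (leg_col_subproof i)).

(** The column type of a box depends on its row, which obstructs direct case
analysis; every box being named by [arm_box] or [leg_box] removes the
dependency. *)
Lemma hook_boxP (c : box (hook a b)) :
  (exists j, c = arm_box j) \/ (exists i, c = leg_box i).
Proof.
case: c => [[[|i] lt_i] [j lt_j]].
  by left; exists (Ordinal lt_j); apply: box_eq.
have lt_ib : (i < b)%N by have := lt_i; rewrite /= size_nseq.
right; exists (Ordinal lt_ib); apply: box_eq => //=.
by move: lt_j; rewrite /= nth_nseq lt_ib; case: j.
Qed.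

Variable n : nat.

Definition filling (m : 'I_n) (s u : seq 'I_n) :
    {ffun box (hook a b) -> 'I_n} :=
  [ffun c : box (hook a b) =>
     if nat_of_ord (tag c) is i.+1 then nth m u i
     else nth m (m :: s) (tagged c)].

(** In a hook only the first row and the first column have more than one box, and
by transitivity the tableau conditions on them reduce to consecutive boxes. *)
Lemma semistandard_filling m (s : a.-tuple 'I_n) (u : b.-tuple 'I_n) :
  semistandard (filling m s u) = path weak m s && path strict m u.
Proof.
have -> : path weak m s = sorted weak (m :: s) by [].
have -> : path strict m u = sorted strict (m :: u) by [].
apply/forallP/andP => [T_ss|[s_weak u_strict] c].
  split; apply/(pathP m); rewrite size_tuple => i lt_i.
    have lt_i1 : (i < a.+1)%N by rewrite ltnW.
    have /forallP/(_ (arm_box (Ordinal (lt_i : (i.+1 < a.+1)%N)))) :=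
      T_ss (arm_box (Ordinal lt_i1)).
    by rewrite !ffunE /= leqnSn => /andP[].
  case: i lt_i => [|i] lt_i.
    have /forallP/(_ (leg_box (Ordinal lt_i))) := T_ss (arm_box ord0).
    by rewrite !ffunE.
  have /forallP/(_ (leg_box (Ordinal lt_i))) :=
    T_ss (leg_box (Ordinal (ltnW lt_i))).
  by rewrite !ffunE /= ltnSn => /andP[].
apply/forallP => d; rewrite !ffunE.
case: (hook_boxP c) => [[i ->]|[i ->]];
  case: (hook_boxP d) => [[j ->]|[j ->]] /=.
- rewrite andbT; apply/implyP => le_ij.
  by apply:
      (sorted_leq_nth (@weak_trans n) (@weak_refl n) m s_weak i j _ _ le_ij);
    rewrite inE /= size_tuple ltn_ord.
- apply/implyP; case: (nat_of_ord i) => //= _.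
  by apply: (sorted_ltn_nth (@strict_trans n) m u_strict 0%N j.+1 _ _ isT);
    rewrite // inE /= size_tuple ltnS.
- by [].
- rewrite ltnS; apply/andP; split; apply/implyP.
    by rewrite andbT -val_eqE /= eqSS => /eqP ->.
  rewrite andbT => lt_ij.
  by apply: (sorted_ltn_nth (@strict_trans n) m u_strict i.+1 j.+1 _ _ lt_ij);
    rewrite // inE /= size_tuple ltnS.
Qed.

Lemma prod_filling (R : comNzRingType) (x : 'rV[R]_n) m
    (s : a.-tuple 'I_n) (u : b.-tuple 'I_n) :
  \prod_(c : box (hook a b)) x 0 (filling m s u c) =
  x 0 m * (\prod_(i <- s) x 0 i) * (\prod_(i <- u) x 0 i).
Proof.
under eq_bigr => c _ do rewrite ffunE.
rewrite (big_box (hook a b)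
  (fun i j => x 0 (if i is k.+1 then nth m u k else nth m (m :: s) j))).
rewrite /= size_nseq big_nat_recl //= big_nat_recl //=; congr (_ * _ * _).
  by rewrite (big_nth m) size_tuple.
rewrite (big_nth m) size_tuple; apply: eq_big_nat => i lt_ib.
by rewrite nth_nseq (andP lt_ib).2 big_nat1.
Qed.

Lemma sum_hook_fillings (R : nmodType)
    (P : pred {ffun box (hook a b) -> 'I_n}) (F : _ -> R) :
  \sum_(T | P T) F T =
  \sum_(m < n) \sum_(s : a.-tuple 'I_n)
    \sum_(u : b.-tuple 'I_n | P (filling m s u)) F (filling m s u).
Proof.
rewrite pair_big /= pair_big_dep /=.
rewrite (reindex (fun p : 'I_n * a.-tuple 'I_n * b.-tuple 'I_n =>
   filling p.1.1 p.1.2 p.2)) //=.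
exists (fun T : {ffun box (hook a b) -> 'I_n} =>
    (T (arm_box ord0), [tuple T (arm_box (lift ord0 j)) | j < a],
     [tuple T (leg_box i) | i < b])) => [[[m s] u] _|T _] /=.
  congr (_, _, _); first by rewrite ffunE.
    by apply: eq_from_tnth => j; rewrite tnth_mktuple ffunE /= (tnth_nth m).
  by apply: eq_from_tnth => j; rewrite tnth_mktuple ffunE /= (tnth_nth m).
apply/ffunP => c; rewrite ffunE; case: (hook_boxP c) => [[j ->]|[i ->]] /=.
  case: (unliftP ord0 j) => [k ->|-> //] /=.
  by rewrite add0n (nth_map k) ?nth_ord_enum ?size_enum_ord.
by rewrite (nth_map i) ?nth_ord_enum ?size_enum_ord.
Qed.

End HookTableaux.

Lemma schur_hook (R : realType) n a b (x : 'rV[R]_n) :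
  schur (hook a b) x = hook_sum a b x.
Proof.
rewrite /schur sum_hook_fillings; apply: eq_bigr => m _.
rewrite [X in X * _]mulr_sumr mulr_suml [RHS]big_mkcond /=.
apply: eq_bigr => s _; case: ifP => s_weak; last first.
  by rewrite big_pred0 // => u; rewrite semistandard_filling s_weak.
rewrite /chain_sum mulr_sumr; apply: eq_big => u; last by rewrite prod_filling.
by rewrite semistandard_filling s_weak.
Qed.

(** * Positivity and the triangle inequality *)

Lemma hook_sum_ge0 (R : numDomainType) n a b (x : 'rV[R]_n) :
  (forall i, 0 <= x 0 i) -> 0 <= hook_sum a b x.
Proof.
move=> x_ge0; have chain_ge0 e c m : 0 <= chain_sum e x c m.
  by apply: sumr_ge0 => s _; apply: prodr_ge0.
by apply: sumr_ge0 => m _; rewrite !mulr_ge0.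
Qed.

Lemma norm_hook_sum (R : numDomainType) n a b (x : 'rV[R]_n) :
  `|hook_sum a b x| <= hook_sum a b (map_mx Num.norm x).
Proof.
have norm_chain e c m : `|chain_sum e x c m| <=
    chain_sum e (map_mx Num.norm x) c m.
  rewrite (le_trans (ler_norm_sum _ _ _)) //; apply: ler_sum => s _.
  by rewrite normr_prod; under [leRHS]eq_bigr do rewrite mxE.
rewrite (le_trans (ler_norm_sum _ _ _)) //; apply: ler_sum => m _.
by rewrite !normrM mxE !ler_pM ?mulr_ge0.
Qed.

Lemma map_hook_sum (R S : comNzRingType) (f : {rmorphism R -> S}) n a b
    (x : 'rV[R]_n) :
  hook_sum a b (map_mx f x) = f (hook_sum a b x).
Proof.
have map_chain e c m : chain_sum e (map_mx f x) c m = f (chain_sum e x c m).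
  rewrite rmorph_sum; apply: eq_bigr => s _; rewrite rmorph_prod.
  by apply: eq_bigr => i _; rewrite mxE.
rewrite rmorph_sum; apply: eq_bigr => m _.
by rewrite !rmorphM !map_chain mxE.
Qed.

Lemma normCE (R : rcfType) (z : R[i]) : `|z| = (Normc.normc z)%:C%C.
Proof. by case: z => a b; rewrite normc_def. Qed.

Lemma normc_term_le (R : realType) n t (z : 'rV[R[i]]_n) (x : nat -> R[i]) :
  (n <= t)%N -> recseq (\prod_(j < n) ('X - (z 0 j)%:P)) x ->
  Normc.normc (x t) <=
    \sum_(k < n) Normc.normc (x k) *
      schur (hook (t - n) (n - k.+1)) (\row_k Normc.normc (z 0 k)).
Proof.
move=> le_nt xz; rewrite -lecR -normCE -{1}(subnKC le_nt).
rewrite (recurrence_closed_form xz) rmorph_sum.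
rewrite (le_trans (ler_norm_sum _ _ _)) //.
apply: ler_sum => k _; rewrite rmorphM /= -normCE schur_hook -map_hook_sum.
rewrite !normrM normrX normrN1 expr1n mul1r mulrC ler_wpM2l //.
rewrite (le_trans (norm_hook_sum _ _ _)) //.
suff -> : map_mx Num.norm z =
    map_mx (real_complex R) (\row_k Normc.normc (z 0 k)) by [].
by apply/matrixP => i j; rewrite !mxE normCE ord1.
Qed.

(** * The extremal sequence *)

(** The sequence is read off the iterates of the window
[(x_s, ..., x_(s+n-1))]. *)
Lemma exists_linear_recurrence (R : pzRingType) n (f : nat -> R)
    (u : 'I_n -> R) :
  (0 < n)%N -> f n = 1 ->
  exists2 x : nat -> R, (forall k : 'I_n, x k = u k) &
    forall s, \sum_(k < n.+1) f k * x (s + k)%N = 0.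
Proof.
move=> n_gt0 fn1; pose g0 k := if insub k is Some i then u i else 0.
pose next (g : nat -> R) k :=
  if (k.+1 < n)%N then g k.+1 else - \sum_(j < n) f j * g j.
pose x s := iter s next g0 0%N.
have window s k : (k < n)%N -> iter s next g0 k = x (s + k)%N.
  elim: k s => [|k IHk] s lt_kn; first by rewrite addn0.
  by rewrite addnS -addSn -IHk ?(ltnW lt_kn) //= /next lt_kn.
exists x => [k|s]; first by rewrite -[x k](window 0%N) // /= /g0 valK.
rewrite big_ord_recr /= fn1 mul1r.
under eq_bigr => k _ do rewrite -window //.
have -> : (s + n = s.+1 + n.-1)%N by lia.
by rewrite -window ?prednK //= /next prednK // ltnn subrr.
Qed.

(** The signs of the initial values are chosen to undo those of
[recurrence_closed_form], so that no cancellation occurs. *)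
Lemma real_extremal_sequence (R : realType) n t (r w : 'rV[R]_n) :
  (0 < n)%N -> (n <= t)%N ->
  (forall k, 0 <= r 0 k) -> (forall k, 0 <= w 0 k) ->
  exists2 x : nat -> R[i],
    recseq (\prod_(j < n) ('X - (map_mx (real_complex R) r 0 j)%:P)) x /\
    (\row_(k < n) x k =
       map_mx (real_complex R) (\row_k ((-1) ^+ odd (n - k.+1) * w 0 k))) &
    Normc.normc (x t) = \sum_(k < n) w 0 k * schur (hook (t - n) (n - k.+1)) r.
Proof.
move=> n_gt0 le_nt r_ge0 w_ge0.
set z := map_mx _ r; set f := \prod_(j < n) _.
have szf : size f = n.+1 by exact: size_prod_XsubC_ord.
have fn1 : f`_n = 1 by exact: coef_prod_XsubC_lead.
pose u (k : 'I_n) := real_complex R ((-1) ^+ odd (n - k.+1) * w 0 k).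
have [x x_init x_rec] := exists_linear_recurrence u n_gt0 fn1.
have xf : recseq f x by move=> s; rewrite szf; exact: x_rec.
exists x; first by split=> //; apply/rowP => k; rewrite !mxE x_init.
rewrite -{1}(subnKC le_nt) (recurrence_closed_form xf).
set S := RHS; have S_ge0 : 0 <= S.
  by apply: sumr_ge0 => k _; rewrite schur_hook mulr_ge0 ?hook_sum_ge0.
suff -> : \sum_(k < n) (-1) ^+ (n - k.+1) *
    hook_sum (t - n) (n - k.+1) z * x k = real_complex R S.
  by apply: complexI; rewrite -normCE ger0_norm // ler0c.
rewrite rmorph_sum; apply: eq_bigr => k _.
rewrite x_init /u /z map_hook_sum -signr_odd -schur_hook !rmorphM /=.
rewrite rmorph_sign.
by rewrite mulrACA -expr2 sqrr_sign mul1r mulrC.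
Qed.

(** * Suprema over Reinhardt domains *)

Lemma inC_absset_sub (R : realType) n (Z : set 'rV[R[i]]_n) :
  Reinhardt Z -> inC (absset Z) `<=` Z.
Proof.
move=> rZ _ [_ [z Zz <-] <-]; apply: rZ Zz _ => k.
by rewrite !mxE -normCE normr_id.
Qed.

Lemma inC_signedset_sub (R : realType) n (U : set 'rV[R[i]]_n) :
  Reinhardt U -> inC (signedset U) `<=` U.
Proof.
move=> rU _ [_ [u Uu [e _ <-]] <-]; apply: rU Uu _ => k.
by rewrite !mxE rmorphM rmorph_sign normrMsign /= -normCE normr_id.
Qed.

Lemma MMsup_subset (R : realType) n t (Z Z' U U' : set 'rV[R[i]]_n) :
  Z `<=` Z' -> U `<=` U' -> (MMsup t Z U <= MMsup t Z' U')%E.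
Proof.
move=> subZ subU; apply: ub_ereal_sup => _ [z Zz <-].
apply: le_trans (ereal_sup_ubound _); last first.
  by exists z; [exact: subZ | reflexivity].
apply: le_ereal_sup => _ [x [xz Ux] <-].
by exists x => //; split=> //; exact: subU.
Qed.

Theorem corollary5p1 (R : realType) (n : nat) (n_gt0 : (0 < n)%N)
    (Z U : set 'rV[R[i]]_n)
    (cZ : compactC Z) (cU : compactC U)
    (rZ : Reinhardt Z) (rU : Reinhardt U)
    (t : nat) (le_nt : (n <= t)%N) :
  MMsup t Z U = MMsup t (inC (absset Z)) (inC (signedset U)) /\
  MMsup t (inC (absset Z)) (inC (signedset U)) =
    ereal_sup [set (\sum_(k < n) w 0 k * schur (hook (t - n) (n - k.+1)) r)%:E
                 | r in absset Z & w in absset U].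
Proof.
set S := ereal_sup [set (\sum_(k < n) _)%:E | r in absset Z & w in absset U].
have upper : (MMsup t Z U <= S)%E.
  apply: ub_ereal_sup => _ [z Zz <-]; apply: ub_ereal_sup => _ [x [xz Ux] <-].
  have := normc_term_le le_nt xz; rewrite -lee_fin => /le_trans; apply.
  apply: ereal_sup_ubound.
  exists (\row_k Normc.normc (z 0 k)); first by exists z.
  exists (\row_k Normc.normc ((\row_(k < n) x k) 0 k)).
    by exists (\row_(k < n) x k).
  by congr _%:E; apply: eq_bigr => k _; rewrite !mxE.
have lower : (S <= MMsup t (inC (absset Z)) (inC (signedset U)))%E.
  apply: ub_ereal_sup => _ [r Zr [w Uw <-]].
  have abs_ge0 D : absset D `<=` [set v : 'rV[R]_n | forall k, 0 <= v 0 k].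
    by move=> _ [z _ <-] k; rewrite mxE -lecR -normCE normr_ge0.
  have [x [xr x_init] <-] :=
    real_extremal_sequence n_gt0 le_nt (abs_ge0 _ _ Zr) (abs_ge0 _ _ Uw).
  apply: le_trans (ereal_sup_ubound _); last first.
    by exists (map_mx (real_complex R) r); [exists r | reflexivity].
  apply: ereal_sup_ubound; exists x => //; split=> //; rewrite x_init.
  eexists; last reflexivity; case: Uw => u Uu <-.
  exists u => //; exists (fun k : 'I_n => odd (n - k.+1)) => //.
  by apply/rowP => k; rewrite !mxE.
have middle : (MMsup t (inC (absset Z)) (inC (signedset U)) <= MMsup t Z U)%E.
  exact: MMsup_subset (inC_absset_sub rZ) (inC_signedset_sub rU).
split; apply/le_anti/andP; split=> //; first exact: le_trans upper lower.
exact: le_trans middle upper.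
Qed.
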